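(* Let $\mathbf{k}$ be a commutative ring containing $\mathbb{Q}$, let $(R,R_n,P)$ be a (not necessarily commutative) complete filtered Rota-Baxter algebra over $\mathbf{k}$ of weight $0$, and let $a_0,a_1\in R_1$ be fixed. Let $\chi_0:R_1\to R_1$ be the zero BCH-recursion operator. Then the equation $$b=P(a_0)+P(a_1b)$$ has the unique solution $b\in R$ given by $$b=\exp(P(\chi_0(a_1)))\,P\left(\exp(-P(\chi_0(a_1)))a_0\right),$$ and moreover $$\sum_{n=0}^\infty \underbrace{P(a_1\cdots P(a_1}_{n}P(a_0))\cdots)=\exp(P(\chi_0(a_1)))\,P\left(\exp(-P(\chi_0(a_1)))a_0\right).$$
   Context: All algebras are associative and unital. A Rota-Baxter algebra of weight $0$ over a commutative ring $\mathbf{k}$ is a pair $(R,P)$ where $R$ is a $\mathbf{k}$-algebra and $P:R\to R$ is a $\mathbf{k}$-linear map with $P(x)P(y)=P(xP(y))+P(P(x)y)$ for all $x,y\in R$. A filtered algebra is an algebra $R$ with non-unitary subalgebras $R_n\subset R$, $n\in\mathbb{N}\cup\{0\}$, such that $R_0=R$, $R_{n+1}\subset R_n$, $\bigcap_n R_n=\{0\}$ and $R_nR_m\subset R_{n+m}$ for all $n,m$. It is complete if the metric $d(x,y)=\inf\{2^{-n} : x-y\in R_n\}$ is complete. $(R,R_n,P)$ is a complete filtered Rota-Baxter algebra of weight $0$ if $(R,P)$ is a Rota-Baxter algebra of weight $0$, $R$ with $(R_n)$ is a complete filtered algebra, and $P(R_n)\subset R_n$ for all $n\ge 0$. Infinite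 sums are limits in the metric $d$. For $x\in R_1$: $\exp(x)=\sum_{n\ge0}x^n/n!$. Zero BCH-recursion operator (known from the literature to be well defined): $\chi_0:R_1\to R_1$ assigns to $a\in R_1$ the unique solution $\chi_0(a)\in R_1$ of $$\chi_0(a)=\frac{\operatorname{ad}_{P(\chi_0(a))}}{\exp(\operatorname{ad}_{P(\chi_0(a))})-1}(a)=\left(1+\sum_{k=1}^\infty\frac{B_k}{k!}\left(\operatorname{ad}_{P(\chi_0(a))}\right)^k\right)(a),$$ where $\operatorname{ad}_x(y)=xy-yx$ and $B_k$ are the Bernoulli numbers defined by $\frac{z}{e^z-1}=1+\sum_{k\ge1}\frac{B_k}{k!}z^k$ (so $B_1=-\tfrac12$). Iterated notation: for $c\in R$, the element $T_n=\underbrace{P(a_1\cdots P(a_1}_{n}P(c))\cdots)$ is defined by $T_0=P(c)$ and $T_{n+1}=P(a_1T_n)$. *)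

(* Defs.v *)
From HB Require Import structures.
From mathcomp Require Import all_boot all_order all_algebra.
From mathcomp Require Import boolp classical_sets reals.

Set Implicit Arguments.
Unset Strict Implicit.
Unset Printing Implicit Defensive.

Import Order.TTheory GRing.Theory Num.Theory.
Local Open Scope classical_set_scope.
Local Open Scope ring_scope.

(* Formal power series over rat are represented by their coefficients
   f : nat -> rat; fps_inv f is the reciprocal of f (for f 0 != 0), computed
   from f * g = 1: the sequence fps_inv_seq f n lists g 0, ..., g n. *)
Fixpoint fps_inv_seq (f : nat -> rat) (n : nat) : seq rat :=
  if n is m.+1 then
    let s := fps_inv_seq f m in
    rcons s (- (f 0%N)^-1 * \sum_(i < m.+1) s`_i * f (m.+1 - i)%N)
  else [:: (f 0%N)^-1].

Definition fps_inv (f : nat -> rat) (n : nat) : rat := (fps_inv_seq f n)`_n.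

(* z / (e^z - 1) is the reciprocal of (e^z - 1) / z = \sum_n z^n / (n+1)!;
   bernoulliP below is the identity (z / (e^z - 1)) * (e^z - 1) = z. *)
Definition bernoulli (k : nat) : rat :=
  k`!%:R * fps_inv (fun n => (n.+1)`!%:R^-1) k.

Lemma size_fps_inv_seq f n : size (fps_inv_seq f n) = n.+1.
Proof. by elim: n => //= n IH; rewrite size_rcons IH. Qed.

Lemma nth_fps_inv_seq f n i : (i <= n)%N -> (fps_inv_seq f n)`_i = fps_inv f i.
Proof.
elim: n => [|n IH]; first by case: i.
rewrite leq_eqVlt => /orP[/eqP -> //|]; rewrite ltnS => le_in.
by rewrite /= nth_rcons size_fps_inv_seq ltnS le_in IH.
Qed.

Lemma fps_invP f n : f 0%N != 0 ->
  \sum_(i < n.+1) fps_inv f i * f (n - i)%N = (n == 0%N)%:R.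
Proof.
move=> f0; case: n => [|n]; first by rewrite big_ord1 /= mulVf.
rewrite big_ord_recr /= subnn {2}/fps_inv /= nth_rcons size_fps_inv_seq ltnn eqxx.
rewrite mulNr mulNr mulrAC mulVf // mul1r; apply/eqP; rewrite subr_eq0; apply/eqP.
by apply: eq_bigr => i _; rewrite nth_fps_inv_seq // -ltnS.
Qed.

Lemma bernoulliP n :
  \sum_(i < n.+1) bernoulli i / i`!%:R * ((n - i)`!%:R^-1 - (n - i == 0)%N%:R)
  = (n == 1%N)%:R.
Proof.
case: n => [|n]; first by rewrite big_ord1 subnn subrr mulr0.
rewrite big_ord_recr /= subnn subrr mulr0 addr0 eqSS.
rewrite -(@fps_invP (fun n => (n.+1)`!%:R^-1)) ?invr_eq0 //.
apply: eq_bigr => -[i /= lt_in] _; rewrite (subSn (ltnSE lt_in)).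
have fact_neq0 : i`!%:R != 0 :> rat by rewrite pnatr_eq0 -lt0n fact_gt0.
by rewrite subr0 /bernoulli (mulrAC i`!%:R) mulfV // mul1r.
Qed.

Lemma bernoulli1 : bernoulli 1 = - 2%:R^-1.
Proof.
by rewrite /bernoulli /fps_inv /= big_ord1; apply/eqP; vm_compute.
Qed.

Section FilteredAlgebra.
Variables (k : comNzRingType) (R : algType k) (F : nat -> set R).

Record is_filtered : Prop := IsFiltered {
  filtered_submod : forall n, GRing.submod_closed [in F n];
  filtered_mul_closed : forall n, GRing.mulr_2closed [in F n];
  filtered_0 : F 0%N = setT;
  filtered_sub : forall n, F n.+1 `<=` F n;
  filtered_sep : \bigcap_n F n = [set 0];
  filtered_mul : forall n m x y, F n x -> F m y -> F (n + m)%N (x * y) }.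

Variable K : realType.

Definition fdist (x y : R) : K := inf [set 2 ^- n | n in [set n | F n (x - y)]].

Definition fcvg_to (u : nat -> R) (l : R) : Prop :=
  forall e : K, 0 < e -> exists N : nat, forall n, (N <= n)%N -> fdist (u n) l < e.

Definition fcauchy (u : nat -> R) : Prop :=
  forall e : K, 0 < e -> exists N : nat, forall m n,
    (N <= m)%N -> (N <= n)%N -> fdist (u m) (u n) < e.

Definition fcomplete : Prop :=
  forall u : nat -> R, fcauchy u -> exists l, fcvg_to u l.

Definition fsums_to (u : nat -> R) (s : R) : Prop :=
  fcvg_to (fun n => \sum_(i < n) u i) s.

(* Sum of a convergent series; 0 if the series diverges. *)
Definition fsum (u : nat -> R) : R := xget 0 [set s | fsums_to u s].

Record is_complete_filtered_RB (P : R -> R) : Prop := IsCompleteFilteredRB {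
  cfRB_filtered : is_filtered;
  cfRB_complete : fcomplete;
  cfRB_RotaBaxter : forall x y, P x * P y = P (x * P y) + P (P x * y);
  cfRB_stable : forall n x, F n x -> F n (P x) }.

(* iota exhibits k as a ring containing the rationals *)
Variable iota : {rmorphism rat -> k}.

Definition fexp (x : R) : R := fsum (fun n => iota (n`!%:R^-1) *: x ^+ n).

Definition ad (x y : R) : R := x * y - y * x.

Definition is_chi0 (P : R -> R) (a c : R) : Prop :=
  F 1%N c /\
  c = a + fsum (fun i => iota (bernoulli i.+1 / (i.+1)`!%:R)
                           *: iter i.+1 (ad (P c)) a).

(* For a in F 1 such a c exists and is unique in the complete case. *)
Definition chi0 (P : R -> R) (a : R) : R := xget 0 [set c | is_chi0 P a c].

End FilteredAlgebra.

(* Main.v *)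
Require Import Defs.
From HB Require Import structures.
From mathcomp Require Import all_boot all_order all_algebra.
From mathcomp Require Import boolp classical_sets reals.
From mathcomp Require Import ring.
Import Order.TTheory GRing.Theory Num.Theory.
Local Open Scope ring_scope.

(** Let [u = P c] with [c = chi_0 (a1)], and [E = exp u].  Everything rests on
    the noncommutative Spitzer identity [E = 1 + P (a1 * E)] (lemma [spitzer]):
    [E] solves the equation with the inhomogeneous term [P a0] replaced by 1.

    Why [E] does so.  In weight 0 the operator [P] behaves like an integral:
    the identity [P x * P y = P (x * P y + P x * y)] gives, by induction,
    [u ^ n = P (x_n)], where [x_n = \sum_i u ^ i * c * u ^ (n - 1 - i)] is the
    derivative of [u ^ n] in the direction [c] (lemma [RB_dpow]).  Moving all
    factors [u] to the right turns [\sum_n x_n / n!] into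
    [((e ^ ad_u - 1) / ad_u) (c) * E], which is the formula for the
    differential of the exponential.  The equation that defines [chi_0] says
    [c = (ad_u / (e ^ ad_u - 1)) (a1)], so the first factor is [a1]
    (lemma [bernoulli_inverse]) and [E - 1 = P (a1 * E)].

    Variation of constants then solves the inhomogeneous equation: for
    [Y = P (E^-1 * a0)] the Rota-Baxter identity applied to
    [P (a1 * E) * Y = (E - 1) * Y] gives
    [E * Y - Y = P (a1 * E * Y) + P (a0 - E^-1 * a0)], that is
    [E * Y = P a0 + P (a1 * (E * Y))].  The map [t |-> P (a1 * t)] raises the
    filtration degree by one, so a solution is unique, and after [n] expansions
    of the equation the remainder lies in [F n]; this gives the series.

    All analysis is done in the filtration: a series whose [i]-th term lies in
    [F i] is identified with its sum modulo every [F n] (predicate [fseries]),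
    and the metric appears only in the dictionary between the two notions.
    Existence of [chi_0] is a fixed point argument: in its defining equation the
    right-hand side depends on [c] through commutators with [a], which lies in
    [F 1], so that it gains one filtration degree. *)

Set Implicit Arguments.
Unset Strict Implicit.
Unset Printing Implicit Defensive.

(** * Iterated commutators and powers *)

Section Commutators.
Context (k : comNzRingType) (R : algType k) (u c : R).

Lemma iter_ad_linear (v : R) m : linear (iter m (ad v) : R -> R).
Proof.
move=> a x y; elim: m => // m IH; rewrite !iterS IH /ad.
by rewrite mulrDl mulrDr -scalerAr -scalerAl scalerBr opprD addrACA.
Qed.

HB.instance Definition _ (v : R) m :=
  GRing.isLinear.Build k R R *:%R (iter m (ad v) : R -> R) (@iter_ad_linear v m).

(** Left multiplication by [u] is [ad u] plus right multiplication by [u], and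
    these two operators commute: this is the binomial theorem for them. *)
Lemma expr_ad n :
  u ^+ n * c = \sum_(l < n.+1) iter (n - l) (ad u) c * u ^+ l *+ 'C(n, l).
Proof.
elim: n => [|n IH]; first by rewrite big_ord1 mul1r mulr1.
pose A m l := iter m (ad u) c * u ^+ l.
have uA m l : u * A m l = A m.+1 l + A m l.+1.
  by rewrite /A iterS {2}/ad mulrBl exprS !mulrA subrK.
rewrite exprS -mulrA IH mulr_sumr.
under eq_bigr => l _ do rewrite mulrnAr uA mulrnDl.
rewrite big_split /= [RHS]big_ord_recl.
under [in RHS]eq_bigr => l _ do rewrite binS mulrnDr.
rewrite big_split /= addrA; congr (_ + _).
rewrite big_ord_recl [X in _ = _ + X]big_ord_recr /= (bin_small (ltnSn n)) mulr0n addr0 subn0 bin0.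
congr (_ + _); apply: eq_bigr => -[l /= lt_ln] _.
by rewrite /bump /= !add1n subSS -subSn.
Qed.

(** The derivative of [u ^ n] in the direction [c], that is the sum of the
    [u ^ i * c * u ^ (n - 1 - i)], with all factors [u] moved to the right.
    This form makes the series of the [dpow n / n!] a Cauchy product with
    [exp u]. *)
Definition dpow n := \sum_(l < n) iter (n.-1 - l) (ad u) c * u ^+ l *+ 'C(n, l).

(** The Leibniz rule for [u ^ n * u], the derivative of [u] being [c]. *)
Lemma dpowS n : dpow n.+1 = dpow n * u + u ^+ n * c.
Proof.
rewrite expr_ad /dpow big_ord_recl [X in _ = _ + X]big_ord_recl addrCA /= !subn0 !bin0.
congr (_ + _); rewrite mulr_suml -big_split; apply: eq_bigr => -[l /= lt_ln] _.
rewrite /bump /= !add1n binS addnC mulrnDr exprSr mulrA mulrnAl; congr (_ *+ _ + _).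
by case: n lt_ln => // n _; rewrite subSS.
Qed.

End Commutators.

(** * Algebra modulo the filtration *)

Section Filtration.
Context (k : comNzRingType) (R : algType k) (F : nat -> set R).
Context (filF : is_filtered F).

Lemma fil_zero n : F n 0.
Proof. by have [/set_mem] := filtered_submod filF n. Qed.

Lemma fil_lin n (a : k) x y : F n x -> F n y -> F n (a *: x + y).
Proof.
have [_ lin] := filtered_submod filF n.
by move=> /mem_set Fx /mem_set Fy; apply: set_mem; apply: lin.
Qed.

Lemma fil_add n x y : F n x -> F n y -> F n (x + y).
Proof. by rewrite -{2}[x]scale1r; apply: fil_lin. Qed.

Lemma fil_scale n (a : k) x : F n x -> F n (a *: x).
Proof. by move=> Fx; rewrite -[_ *: _]addr0; apply: fil_lin => //; exact: fil_zero. Qed.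

Lemma fil_opp n x : F n x -> F n (- x).
Proof. by rewrite -scaleN1r; apply: fil_scale. Qed.

Lemma fil_sub n x y : F n x -> F n y -> F n (x - y).
Proof. by move=> Fx Fy; apply: fil_add => //; apply: fil_opp. Qed.

Lemma fil_subC n x y : F n (x - y) -> F n (y - x).
Proof. by move/fil_opp; rewrite opprB. Qed.

Lemma fil_sub_trans n y x z : F n (x - y) -> F n (y - z) -> F n (x - z).
Proof. by move=> Fxy Fyz; rewrite -(subrKA y); apply: fil_add. Qed.

Lemma fil_sum n (I : Type) (r : seq I) (Q : pred I) (u : I -> R) :
  (forall i, Q i -> F n (u i)) -> F n (\sum_(i <- r | Q i) u i).
Proof. by move=> Fu; apply: big_ind => //; [exact: fil_zero | exact: fil_add]. Qed.

Lemma fil_le m n x : (m <= n)%N -> F n x -> F m x.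
Proof.
move=> /subnK <-; elim: (n - m)%N => // p IH Fx; apply: IH.
exact: (filtered_sub filF).
Qed.

Lemma fil_all x : F 0%N x.
Proof. by rewrite (filtered_0 filF). Qed.

Lemma fil_eq x y : (forall n, F n (x - y)) -> x = y.
Proof.
move=> Fxy; apply/eqP; rewrite -subr_eq0; apply/eqP.
have : (\bigcap_n F n)%classic (x - y) by move=> n _; apply: Fxy.
by rewrite (filtered_sep filF).
Qed.

Lemma fil_exp x n : F 1%N x -> F n (x ^+ n).
Proof.
move=> Fx; elim: n => [|n IH]; first exact: fil_all.
by rewrite exprS -add1n; apply: (filtered_mul filF).
Qed.

Lemma fil_ad m n x y : F m x -> F n y -> F (m + n)%N (ad x y).
Proof.
move=> Fx Fy; apply: fil_sub; first exact: (filtered_mul filF).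
by rewrite addnC; apply: (filtered_mul filF).
Qed.

Lemma fil_iter_ad u m n x : F 1%N u -> F n x -> F (m + n)%N (iter m (ad u) x).
Proof.
move=> Fu Fx; elim: m => // m IH; rewrite iterS addSn -add1n.
exact: fil_ad.
Qed.

Lemma fil_iter_ad0 u m x : F 1%N u -> F m (iter m (ad u) x).
Proof. by move=> Fu; have := fil_iter_ad m Fu (fil_all x); rewrite addn0. Qed.

(** Replacing the factors [v] by [u] one at a time, each change carries a factor
    [u - v] in [F n] next to a commutator that still contains [a], which
    accounts for the additional degree 1. *)
Lemma fil_iter_ad_contract n u v a m : F 1%N a -> F 1%N v -> F n (u - v) ->
  F n.+1 (iter m (ad u) a - iter m (ad v) a).
Proof.
move=> Fa Fv Fuv; elim: m => [|m IH]; first by rewrite subrr; apply: fil_zero.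
rewrite !iterS; set x := iter m _ _; set y := iter m _ _.
have -> : ad u x - ad v y = ad u (x - y) + ad (u - v) y.
  rewrite /ad !(mulrBl, mulrBr) [RHS]addrACA -opprD !subrKA !opprB.
  by rewrite (addrC (y * v)) addrACA (addrC (- (x * u))).
apply: fil_add; first by apply: (fil_ad (fil_all u)); apply: IH.
rewrite -addn1; apply: fil_ad => //.
by apply: (@fil_le _ (m + 1)%N); [rewrite addn1 | apply: fil_iter_ad].
Qed.

(** Convergence at the rate forced by terms of degree [i] at place [i].  The
    fixed rate makes it a statement of pure algebra, one congruence for each
    [n], with no choice of thresholds. *)
Definition fseries (u : nat -> R) (s : R) : Prop :=
  forall n, F n (s - \sum_(i < n) u i).

Lemma fseries_unique u s t : fseries u s -> fseries u t -> s = t.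
Proof.
by move=> us ut; apply: fil_eq => n; apply: fil_sub_trans (us n) (fil_subC (ut n)).
Qed.

Lemma eq_fseries u v s : u =1 v -> fseries u s -> fseries v s.
Proof.
move=> uv us n; suff <- : \sum_(i < n) u i = \sum_(i < n) v i by [].
by apply: eq_bigr => i _; apply: uv.
Qed.

Lemma fseries_recl u s : (forall i, F i (u i)) ->
  fseries (fun i => u i.+1) s -> fseries u (u 0%N + s).
Proof.
move=> Fu us n.
have shift : u 0%N + \sum_(i < n) u i.+1 = \sum_(i < n) u i + u n.
  by have := @big_ord_recr R 0 +%R n (fun i => u i); rewrite big_ord_recl.
have -> : u 0%N + s - \sum_(i < n) u i = (s - \sum_(i < n) u i.+1) + u n.
  by apply/eqP; rewrite subr_eq -addrA (addrC (u n)) -shift addrCA subrK.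
exact: fil_add.
Qed.

Lemma fseries_delta x : fseries (fun n => (n == 0%N)%:R *: x) x.
Proof.
case=> [|n]; first exact: fil_all.
rewrite big_ord_recl scale1r big1 ?addr0 ?subrr; first exact: fil_zero.
by move=> i _; rewrite scale0r.
Qed.

(** Both sides sum [G m i] over the triangle [m + i < N]. *)
Lemma sum_antidiag (G : nat -> nat -> R) N :
  \sum_(n < N) \sum_(l < n.+1) G (n - l)%N l = \sum_(m < N) \sum_(i < N - m) G m i.
Proof.
elim: N => [|N IH]; first by rewrite !big_ord0.
rewrite big_ord_recr /= IH [RHS]big_ord_recr /= subSnn big_ord1.
rewrite [X in _ + X](reindex_inj rev_ord_inj) /= [X in _ + X = _]big_ord_recr /= subnn subn0 addrA.
congr (_ + _); rewrite -big_split; apply: eq_bigr => -[m /= ltmN] _.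
by have leNm := ltnW ltmN; rewrite subSS subKn // subSn // big_ord_recr.
Qed.

(** Summing a double series by rows [h m] or by antidiagonals gives the same
    value.  Both the Cauchy product and the composition of the two power series
    in [ad u] are instances; the row tails need the degree shift [m]. *)
Lemma fseries_double (G : nat -> nat -> R) h s :
    fseries h s -> (forall m n, F (m + n)%N (h m - \sum_(i < n) G m i)) ->
  fseries (fun n => \sum_(l < n.+1) G (n - l)%N l) s.
Proof.
move=> hs Gh N; rewrite sum_antidiag; apply: fil_sub_trans (hs N) _.
rewrite -sumrB; apply: fil_sum => -[m /= ltmN] _.
by rewrite -{1}(subnKC (ltnW ltmN)); apply: Gh.
Qed.

Lemma fseriesM A B s t :
    (forall m, F m (A m)) -> fseries A s -> fseries B t ->
  fseries (fun n => \sum_(l < n.+1) A (n - l)%N * B l) (s * t).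
Proof.
move=> FA As Bt; apply: (@fseries_double (fun m l => A m * B l) (fun m => A m * t)).
  move=> n; rewrite -mulr_suml -mulrBl -[n]addn0.
  by apply: (filtered_mul filF); [rewrite addn0; apply: As | exact: fil_all].
by move=> m n; rewrite -mulr_sumr -mulrBr; apply: (filtered_mul filF).
Qed.

End Filtration.

(** * Sums, fixed points and exponentials in a complete filtered algebra *)

Section Complete.
Context (K : realType) (k : comNzRingType) (R : algType k) (F : nat -> set R).
Context (filF : is_filtered F).

Lemma fdist_le n x y : F n (x - y) -> fdist F K x y <= 2 ^- n.
Proof.
move=> Fxy; apply: ge_inf; last by exists n.
by exists 0 => _ [m _ <-]; rewrite invr_ge0 exprn_ge0.
Qed.

Lemma fdist_lt n x y : fdist F K x y < 2 ^- n -> F n (x - y).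
Proof.
move=> /inf_lt[|_ [m Fm <-]]; first by exists (2 ^- 0), 0%N => //; exact: fil_all.
rewrite ltf_pV2 ?posrE ?exprn_gt0 // ltr_eXn2l ?ltr1n // => /ltnW le_nm.
exact: fil_le le_nm Fm.
Qed.

Lemma expV2_lt (e : K) : 0 < e -> exists n, 2 ^- n < e.
Proof.
move=> e0; exists (Num.Def.archi_bound e^-1).
rewrite -[ltRHS]invrK ltf_pV2 ?posrE ?exprn_gt0 ?invr_gt0 //.
exact: upper_nthrootP.
Qed.

Lemma fcvg_toP u l :
  fcvg_to F K u l <-> forall n, exists N, forall m, (N <= m)%N -> F n (u m - l).
Proof.
split=> [ul n | ul e /expV2_lt[n lt_ne]].
  have [|N uN] := ul (2 ^- n); first by rewrite invr_gt0 exprn_gt0.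
  by exists N => m /uN /fdist_lt.
have [N uN] := ul n; exists N => m /uN /fdist_le le_n.
exact: le_lt_trans lt_ne.
Qed.

Lemma fseries_fsums u s : fseries F u s -> fsums_to F K u s.
Proof.
move=> us; apply/fcvg_toP => n; exists n => m le_nm.
by apply: fil_le le_nm _ => //; apply: fil_subC.
Qed.

(** A sum in the metric automatically converges at the filtration rate: compare
    with a later partial sum, the terms in between being in [F n]. *)
Lemma fsums_fseries u s : (forall i, F i (u i)) -> fsums_to F K u s -> fseries F u s.
Proof.
move=> Fu /fcvg_toP us n; have [N uN] := us n.
apply: (fil_sub_trans filF (fil_subC filF (uN (n + N)%N (leq_addl n N)))).
rewrite big_split_ord /= addrAC subrr add0r; apply: fil_sum => // i _.
exact: fil_le (leq_addr i n) (Fu _).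
Qed.

Hypothesis complF : fcomplete F K.

Lemma fsumP u : (forall i, F i (u i)) -> fseries F u (fsum F K u).
Proof.
move=> Fu; apply: fsums_fseries => //.
suff /complF[l ul] : fcauchy F K (fun n => \sum_(i < n) u i).
  by apply: (@xgetPex _ 0 [set s | fsums_to F K u s]%classic); exists l.
move=> e /expV2_lt[N lt_Ne].
have uN m : (N <= m)%N -> F N (\sum_(i < m) u i - \sum_(i < N) u i).
  move=> /subnKC <-; rewrite big_split_ord /= addrAC subrr add0r.
  by apply: fil_sum => // i _; apply: fil_le (leq_addr i N) (Fu _).
exists N => m n leNm leNn; apply: le_lt_trans lt_Ne; apply: fdist_le.
exact: fil_sub_trans (uN m leNm) (fil_subC filF (uN n leNn)).
Qed.

(** Banach's fixed point theorem: the iterates from 0 have their successive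
    differences in [F n], so that their telescoping series converges. *)
Lemma contraction_fixpoint (Phi : R -> R) :
    (forall x, F 1%N x -> F 1%N (Phi x)) ->
    (forall n x y, F 1%N x -> F 1%N y -> F n (x - y) -> F n.+1 (Phi x - Phi y)) ->
  exists2 x, F 1%N x & Phi x = x.
Proof.
move=> Phi1 PhiC; pose c n := iter n Phi 0.
have Fc n : F 1%N (c n) by elim: n => [|n IH]; [exact: fil_zero | exact: Phi1].
have dc n : F n (c n.+1 - c n).
  elim: n => [|n IH]; first exact: fil_all.
  exact: (PhiC n (c n.+1) (c n) (Fc _) (Fc _) IH).
have cl := fsumP dc; set l := fsum _ _ _ in cl.
have {}cl n : F n (l - c n).
  have := cl n; rewrite -(big_mkord xpredT (fun i => c i.+1 - c i)).
  by rewrite telescope_sumr // subr0.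
have Fl : F 1%N l by rewrite -[l](subrK (c 1%N)); apply: fil_add.
exists l => //; apply: (fil_eq filF) => n; apply: (fil_sub_trans filF (y := c n.+1)).
  by apply: fil_le (leqnSn n) _ => //; apply: PhiC.
by apply: fil_subC => //; apply: fil_le (leqnSn n) _.
Qed.

Context (iota : {rmorphism rat -> k}).
Local Notation fexp := (fexp F K iota).

Lemma fexpP x : F 1%N x -> fseries F (fun n => iota (n`!%:R^-1) *: x ^+ n) (fexp x).
Proof. by move=> Fx; apply: fsumP => i; apply: fil_scale => //; apply: fil_exp. Qed.

Lemma invfact_bin n l : (l <= n)%N ->
  (n - l)`!%:R^-1 * l`!%:R^-1 = n`!%:R^-1 * 'C(n, l)%:R :> rat.
Proof.
have fu m : m`!%:R != 0 :> rat by rewrite pnatr_eq0 -lt0n fact_gt0.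
move=> le_ln; rewrite -(bin_fact le_ln) !natrM; field.
by rewrite !fu pnatr_eq0 -lt0n bin_gt0.
Qed.

Lemma fexpN x : F 1%N x -> fexp x * fexp (- x) = 1.
Proof.
move=> Fx; have FNx : F 1%N (- x) by apply: fil_opp.
have Ft i : F i (iota i`!%:R^-1 *: x ^+ i) by apply: fil_scale => //; apply: fil_exp.
have := fseriesM filF Ft (fexpP Fx) (fexpP FNx).
move/(fseries_unique filF); apply.
apply: eq_fseries (fseries_delta filF 1) => n /=.
(* The Cauchy product has the terms [(x - x) ^ n / n!] by the binomial theorem. *)
transitivity (iota n`!%:R^-1 *: (x - x) ^+ n).
  by rewrite subrr expr0n; case: n => [|n]; rewrite ?scaler0 ?scale0r ?fact0 ?invr1 ?rmorph1.
rewrite exprDn_comm; last exact/commrN.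
rewrite scaler_sumr; apply: eq_bigr => -[l /= le_ln] _.
rewrite -scalerAl -scalerAr scalerA -rmorphM invfact_bin // rmorphM rmorph_nat.
by rewrite -scaler_nat scalerA.
Qed.

Lemma fseries_linear (L : {linear R -> R}) u s :
  (forall n x, F n x -> F n (L x)) -> fseries F u s -> fseries F (L \o u) (L s).
Proof. by move=> FL us n; rewrite -linear_sum -linearB; apply: FL. Qed.

(** * The Rota-Baxter operator and the BCH recursion *)

Context (P : {linear R -> R}).
Hypothesis RB : forall x y, P x * P y = P (x * P y) + P (P x * y).
Hypothesis FP : forall n x, F n x -> F n (P x).

(** The weight-0 identity is integration by parts, so [P] undoes the derivative
    of [u ^ n] in the direction [c] when [u = P c]. *)
Lemma RB_dpow c n : P (dpow (P c) c n.+1) = P c ^+ n.+1.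
Proof.
elim: n => [|n IH]; first by rewrite /dpow big_ord1 mulr1.
by rewrite exprSr -IH RB IH dpowS linearD.
Qed.

(** The choice made by [chi0] is not vacuous: the right-hand side of its equation
    is a contraction of [F 1]. *)
Lemma chi0P a : F 1%N a -> is_chi0 F K iota P a (chi0 F K iota P a).
Proof.
move=> Fa; apply: (@xgetPex _ 0 [set c | is_chi0 F K iota P a c]%classic).
pose t c i := iota (bernoulli i.+1 / i.+1`!%:R) *: iter i.+1 (ad (P c)) a.
have Ft c i : F 1%N c -> F i.+2 (t c i).
  move=> Fc; apply: fil_scale => //; rewrite -addn1.
  by apply: fil_iter_ad => //; apply: FP.
have ts c : F 1%N c -> fseries F (t c) (fsum F K (t c)).
  by move=> Fc; apply: fsumP => i; apply: fil_le (Ft _ i Fc) => //; rewrite ltnW.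
have [|n x y Fx Fy Fxy|c Fc cE] := @contraction_fixpoint (fun c => a + fsum F K (t c)).
- move=> c Fc; apply: fil_add => //; rewrite -[fsum F K _](subrK (\sum_(i < 1) t c i)).
  apply: (fil_add filF (ts c Fc 1%N)); rewrite big_ord1.
  exact: fil_le (Ft c 0%N Fc).
- rewrite opprD addrACA subrr add0r.
  apply: (fil_sub_trans filF (ts x Fx n.+1)).
  apply: (fil_sub_trans filF _ (fil_subC filF (ts y Fy n.+1))).
  rewrite -sumrB; apply: fil_sum => // i _; rewrite -scalerBr.
  apply: fil_scale => //; apply: fil_iter_ad_contract => //; first exact: FP.
  by rewrite -linearB; apply: FP.
by exists c.
Qed.

(** The power series [z / (e ^ z - 1)] and [(e ^ z - 1) / z] are mutually inverse,
    hence so are the operators that they define at [z = ad u]: from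
    [c = (ad u / (e ^ (ad u) - 1)) (a)] one recovers
    [a = ((e ^ (ad u) - 1) / ad u) (c)]. *)
Lemma bernoulli_inverse u a c : F 1%N u ->
    c = a + fsum F K (fun i => iota (bernoulli i.+1 / i.+1`!%:R)
                                 *: iter i.+1 (ad u) a) ->
  fseries F (fun m => iota (m.+1`!%:R^-1) *: iter m (ad u) c) a.
Proof.
move=> Fu cE; pose f n : rat := n.+1`!%:R^-1.
pose t i := iota (fps_inv f i) *: iter i (ad u) a.
have Ft i : F i (t i).
  by apply: fil_scale => //; apply: fil_iter_ad0.
have ct : fseries F t c.
  have t0 : t 0%N = a by rewrite /t /fps_inv /f /= !invr1 rmorph1 scale1r.
  have tE i : iota (bernoulli i.+1 / i.+1`!%:R) *: iter i.+1 (ad u) a = t i.+1.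
    rewrite /t /bernoulli mulrAC mulfV ?mul1r //.
    by rewrite pnatr_eq0 -lt0n fact_gt0.
  rewrite cE -{1}t0; apply: fseries_recl => //.
  under [X in fsum _ _ X]eq_fun => i do rewrite tE.
  by apply: fsumP => // i; apply: fil_le (leqnSn i) _.
pose A m := iota (f m) *: iter m (ad u) c.
have FA m : F m (A m).
  by apply: fil_scale => //; apply: fil_iter_ad0.
have As := fsumP FA; suff <- : fsum F K A = a by [].
(* The antidiagonal coefficients of [G] are those of the product of a power
   series with its reciprocal, so that only the constant term [a] survives. *)
pose G m i := iota (f m) *: iter m (ad u) (t i).
have GA m n : F (m + n)%N (A m - \sum_(i < n) G m i).
  rewrite -scaler_sumr -scalerBr -linear_sum -linearB.
  by apply: fil_scale => //; apply: fil_iter_ad.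
apply: (fseries_unique filF (fseries_double filF As GA)).
apply: eq_fseries (fseries_delta filF a) => n /=.
transitivity ((\sum_(l < n.+1) iota (fps_inv f l * f (n - l)%N)) *: iter n (ad u) a).
  rewrite -rmorph_sum fps_invP ?rmorph_nat; last by rewrite invr_eq0.
  by case: n => // n; rewrite !scale0r.
rewrite scaler_suml; apply: eq_bigr => -[l /= le_ln] _.
by rewrite /G /t linearZ /= scalerA -iterD subnK // mulrC rmorphM.
Qed.

(** Spitzer's identity in weight 0.  The series of [a * exp u] is that of
    the [dpow (n + 1) / (n + 1)!], which [P] maps term by term to the exponential
    series without its constant term. *)
Lemma spitzer a c : is_chi0 F K iota P a c ->
  fexp (P c) = 1 + P (a * fexp (P c)).
Proof.
move=> [Fc cE]; have Fu := FP Fc; set u := P c in Fu *.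
have Fe i : F i (iota i`!%:R^-1 *: u ^+ i) by apply: fil_scale => //; apply: fil_exp.
apply: (fseries_unique filF (fexpP Fu)).
have -> : 1 = iota 0`!%:R^-1 *: u ^+ 0 :> R by rewrite fact0 invr1 rmorph1 scale1r.
apply: (fseries_recl filF (u := fun i => iota i`!%:R^-1 *: u ^+ i)) => //.
have FA m : F m (iota m.+1`!%:R^-1 *: iter m (ad u) c).
  by apply: fil_scale => //; apply: fil_iter_ad0.
have := fseriesM filF FA (bernoulli_inverse Fu cE) (fexpP Fu).
move/(fseries_linear FP); apply: eq_fseries => n /=.
rewrite -RB_dpow -/u -linearZ; congr (P _).
rewrite /dpow scaler_sumr; apply: eq_bigr => -[l /= le_ln] _.
rewrite -scalerAl -scalerAr scalerA -rmorphM -subSn // invfact_bin 1?ltnW //.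
by rewrite rmorphM rmorph_nat -scaler_nat scalerA.
Qed.

End Complete.

(** * The fixed point equation *)

Theorem corollary2p1 (K : realType) (k : comNzRingType)
    (iota : {rmorphism rat -> k}) (R : algType k) (F : nat -> set R)
    (P : {linear R -> R}) (a0 a1 : R)
    (cfRB : is_complete_filtered_RB F K P)
    (Fa0 : F 1%N a0) (Fa1 : F 1%N a1) :
  let c := chi0 F K iota P a1 in
  let s := fexp F K iota (P c) * P (fexp F K iota (- P c) * a0) in
  (forall b : R, b = P a0 + P (a1 * b) <-> b = s) /\
  fsums_to F K (fun n => iter n (fun t => P (a1 * t)) (P a0)) s.
Proof.
move=> c s; case: cfRB => filF complF RB FP.
have chi_c := chi0P filF complF iota FP Fa1; rewrite -/c in chi_c.
have EE := fexpN filF complF iota (FP _ _ (proj1 chi_c)).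
have EP := spitzer filF complF RB FP chi_c.
pose L t := P (a1 * t).
have LB x y : L x - L y = L (x - y) by rewrite /L mulrBr linearB.
have FL n x y : F n (x - y) -> F n.+1 (L x - L y).
  by move=> Fxy; rewrite LB; apply: FP; rewrite -add1n; apply: (filtered_mul filF).
(* Variation of constants: [E] and [E'] are [exp (P c)] and its inverse. *)
have s_sol : s = P a0 + L s.
  rewrite /L {1}/s; move: EP EE; set E := fexp _ _ _ (P c); set E' := fexp _ _ _ _.
  move=> EP EE; rewrite {1}EP mulrDl mul1r RB.
  have -> : P (a1 * E) = E - 1 by rewrite {2}EP addrC addKr.
  rewrite mulrBl mul1r mulrA EE mul1r linearB mulrA.
  by rewrite addrC -addrA subrK addrC.
split=> [b|]; first (split=> [b_sol | ->//]).
  apply: (fil_eq filF); elim=> [|n IH]; first exact: fil_all.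
  by rewrite b_sol s_sol opprD addrACA subrr add0r; apply: FL.
apply: fseries_fsums => // n.
(* Expanding the equation [n] times leaves the remainder [L ^ n (s)]. *)
have -> : s - \sum_(i < n) iter i L (P a0) = iter n L s.
  elim: n => [|n IH]; first by rewrite big_ord0 subr0.
  rewrite big_ord_recl {1}s_sol opprD addrACA subrr add0r iterS -IH -LB.
  congr (_ - _); rewrite /L mulr_sumr linear_sum.
  by apply: eq_bigr.
elim: n => [|n IH]; first exact: fil_all.
by have := FL n (iter n L s) 0; rewrite !subr0 /L mulr0 linear0 subr0; apply.
Qed.
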